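(* Let $n\ge 1$ and let $\alpha=(\alpha_0,\ldots,\alpha_{n-1})\in\mathbf{K}^n$ be arbitrary. Define $$W[\alpha]^{sk}_i=\alpha_{(s+k-i)\bmod n},\qquad 0\le i,s,k\le n-1.$$ Then $W=W[\alpha]$ satisfies, for all indices $i,s,q,p\in\{0,\ldots,n-1\}$, $$W^{sp}_i=W^{ps}_i,\qquad \sum_{k=0}^{n-1}\left(W_i^{sk}W_k^{qp}-W_i^{qk}W_k^{sp}\right)=0.$$ Consequently, for every Lie algebra $\mathcal{G}$ over $\mathbf{K}$, the formula $$([\mathbf{x},\mathbf{y}]^{\alpha})_i=\sum_{s,k=0}^{n-1}\alpha_{(s+k-i)\bmod n}\,[x_s,y_k],\qquad 0\le i\le n-1,$$ defines a Lie bracket on $\mathcal{G}^n$, and the family of brackets $[\cdot,\cdot]^{\alpha}$, $\alpha\in\mathbf{K}^n$, is a linear bundle of Lie algebras $(\mathcal{G}^n,\mathbf{K}^n)$.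
   Context: $\mathbf{K}$ is one of the classical fields ($\mathbb{R}$ or $\mathbb{C}$). $\mathcal{G}$ is a Lie algebra over $\mathbf{K}$ with bracket $[\cdot,\cdot]$, not necessarily finite-dimensional. Elements of $\mathcal{G}^n$ are written $\mathbf{x}=(x_0,\ldots,x_{n-1})$ with $x_i\in\mathcal{G}$, and $\mathcal{G}^n$ is considered here as a vector space. A linear bundle of Lie algebras $(\mathcal{H},V)$ consists of vector spaces $\mathcal{H}$ and $V$ over $\mathbf{K}$ together with, for each $v\in V$, a Lie bracket $[\cdot,\cdot]_v$ on $\mathcal{H}$ such that $[X,Y]_{a_1v_1}+[X,Y]_{a_2v_2}=[X,Y]_{a_1v_1+a_2v_2}$ and $[X,Y]_{av}=a[X,Y]_v$ for all $X,Y\in\mathcal{H}$, $v,v_1,v_2\in V$, $a,a_1,a_2\in\mathbf{K}$. *)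

(* Defs.v *)
From HB Require Import structures.
From mathcomp Require Import all_boot all_order all_algebra.
From mathcomp Require Import reals.
From mathcomp Require Import complex.

Set Implicit Arguments.
Unset Strict Implicit.
Unset Printing Implicit Defensive.

Import GRing.Theory.
Local Open Scope ring_scope.

(* A realType is a complete archimedean ordered field, i.e. a model of the
   field of real numbers; R[i] is then the field of complex numbers. *)
Variant classical_field_kind := RealNumbers | ComplexNumbers.

Definition classical_field (R : realType) (c : classical_field_kind) :
    fieldType :=
  match c with
  | RealNumbers => R
  | ComplexNumbers => R[i]
  end.

Definition lie_bracket (K : fieldType) (V : lmodType K) (br : V -> V -> V) :
    Prop :=
  [/\ bilinear_for *:%R *:%R br,
      forall x, br x x = 0
    & forall x y z, br x (br y z) + br y (br z x) + br z (br x y) = 0].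

Definition linear_lie_bundle (K : fieldType) (H V : lmodType K)
    (br : V -> H -> H -> H) : Prop :=
  [/\ forall v, lie_bracket (br v),
      forall (a1 a2 : K) (v1 v2 : V) (X Y : H),
        br (a1 *: v1) X Y + br (a2 *: v2) X Y = br (a1 *: v1 + a2 *: v2) X Y
    & forall (a : K) (v : V) (X Y : H), br (a *: v) X Y = a *: br v X Y].

(* Index tuples have length n.+1 >= 1.  The index type 'I_n.+1 = {0, ..., n}
   carries the additive group structure of the integers modulo n.+1, so that
   s + k - i is (s + k - i) mod n.+1, computed in 'I_n.+1. *)
Fact val_index_mod (n : nat) (s k i : 'I_n.+1) :
  (s + k - i)%R = ((s + k + (n.+1 - i)) %% n.+1)%N :> nat.
Proof. by rewrite /= modnDm. Qed.

(* W alpha s k i is the structure constant with upper indices s, k and lower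
   index i. *)
Definition W (K : fieldType) (n : nat) (alpha : 'rV[K]_n.+1)
    (s k i : 'I_n.+1) : K :=
  alpha 0 (s + k - i).

Definition alpha_bracket (K : fieldType) (n : nat) (G : lmodType K)
    (br : G -> G -> G) (alpha : 'rV[K]_n.+1) (x y : {ffun 'I_n.+1 -> G}) :
    {ffun 'I_n.+1 -> G} :=
  [ffun i => \sum_(s < n.+1) \sum_(k < n.+1)
               alpha 0 (s + k - i) *: br (x s) (y k)].

(* Main.v *)
Require Import Defs.
From HB Require Import structures.
From mathcomp Require Import all_boot all_order all_algebra.
From mathcomp Require Import reals.

Set Implicit Arguments.
Unset Strict Implicit.
Unset Printing Implicit Defensive.

(** Write [N] for [n.+1], the length of the tuples.  The numbers [W alpha s k i]
    are the structure constants of a commutative associative product on [K^N].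
    In the group algebra of the integers modulo [N], with basis
    [e_0, ..., e_(N-1)], this product is
    [e_s * e_k = sum_i alpha_(s+k-i) e_i = e_s e_k a] (the product of the
    group algebra on the right), with [a = sum_j alpha_j e_(-j)], that is, the
    convolution product twisted by the fixed element [a].  The first two
    identities express commutativity and, in the form
    [e_s * (e_q * e_p) = e_q * (e_s * e_p)], associativity; the latter is a
    translation of the summation index ([W_compC]).

    The bracket on [G^N] is the extension of scalars of the bracket of [G] to
    this commutative associative algebra.  A bracket obtained in this way is
    alternating because the structure constants are symmetric
    ([sum_alternating]), and the coefficient of
    [br (x a) (br (y b) (z c))] in an iterated bracket is the structure
    constant of a triple product, which is invariant under cyclic permutations
    ([W_comp_rot]); the three terms of the Jacobi identity in [G^N] therefore
    carry the same coefficients, and the Jacobi identity of [G] applies term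
    by term.  Linearity in [alpha] is visible in the formula. *)

Import GRing.Theory.
Local Open Scope ring_scope.

Section StructureConstants.

Variables (K : fieldType) (n : nat) (alpha : 'rV[K]_n.+1).
Implicit Types i s q p : 'I_n.+1.

Lemma WC i s p : W alpha s p i = W alpha p s i.
Proof. by rewrite /W [s + p]addrC. Qed.

(** Both sums are [sum_k alpha_(s+k-i) alpha_(q+p-k)], up to the translation of
    [k] by [q - s]. *)
Lemma W_compC i s q p :
  \sum_(k < n.+1) W alpha s k i * W alpha q p k =
  \sum_(k < n.+1) W alpha q k i * W alpha s p k.
Proof.
rewrite (reindex_inj (addIr (q - s))) /=; apply: eq_bigr => k _.
rewrite /W; congr (alpha 0 _ * alpha 0 _).
  by rewrite [k + _]addrC addrA addrCA subrr addr0.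
rewrite opprD opprB [- k + _]addrC addrA; congr (_ - k).
by rewrite [q + p]addrC [s - q]addrC addrA addrK addrC.
Qed.

(** The coefficient of [e_i] in a triple product does not change under cyclic
    permutations of the factors. *)
Lemma W_comp_rot i s q p :
  \sum_(k < n.+1) W alpha s k i * W alpha q p k =
  \sum_(k < n.+1) W alpha q k i * W alpha p s k.
Proof. by rewrite W_compC; under eq_bigr do rewrite [W alpha s p _]WC. Qed.

End StructureConstants.

(** The diagonal terms vanish and the others cancel in pairs; arguing this way,
    instead of showing that the sum is its own opposite, covers
    characteristic 2 as well. *)
Lemma sum_alternating (V : zmodType) (m : nat) (F : 'I_m -> 'I_m -> V) :
    (forall s, F s s = 0) -> (forall s k, F s k = - F k s) ->
  \sum_s \sum_k F s k = 0.
Proof.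
move=> F0 FN; pose A (s k : 'I_m) : V := if (k < s)%N then F s k else 0.
have FE (s k : 'I_m) : F s k = A s k - A k s.
  rewrite /A; case: ltngtP => [_|_|/val_inj ->]; first by rewrite subr0.
    by rewrite sub0r FN.
  by rewrite F0 subr0.
under eq_bigr => s _ do under eq_bigr => k _ do rewrite FE.
under eq_bigr => s _ do rewrite sumrB.
by rewrite sumrB [X in _ - X]exchange_big subrr.
Qed.

Section LieBracket.

Variables (K : fieldType) (G : lmodType K) (br : G -> G -> G).
Hypothesis lie_br : lie_bracket br.

Let br_linearl y : linear (br^~ y). Proof. by case: lie_br => [[]]. Qed.
Let br_linearr x : linear (br x). Proof. by case: lie_br => [[]]. Qed.

Lemma lie_alternating x : br x x = 0. Proof. by case: lie_br. Qed.

Lemma lie_jacobi x y z : br x (br y z) + br y (br z x) + br z (br x y) = 0.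
Proof. by case: lie_br. Qed.

Lemma lie_addl y x1 x2 : br (x1 + x2) y = br x1 y + br x2 y.
Proof. by have := br_linearl y 1 x1 x2; rewrite /= !scale1r. Qed.

Lemma lie_addr x y1 y2 : br x (y1 + y2) = br x y1 + br x y2.
Proof. by have := br_linearr x 1 y1 y2; rewrite !scale1r. Qed.

Lemma lie_0r x : br x 0 = 0.
Proof. by apply: (addrI (br x 0)); rewrite -lie_addr !addr0. Qed.

Lemma lie_scaler x a y : br x (a *: y) = a *: br x y.
Proof. by have := br_linearr x a y 0; rewrite lie_0r !addr0. Qed.

Lemma lie_anticomm x y : br x y = - br y x.
Proof.
apply/eqP; rewrite -addr_eq0; apply/eqP; have := lie_alternating (x + y).
by rewrite lie_addl !lie_addr !lie_alternating addr0 add0r.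
Qed.

Lemma lie_sumr (I : Type) (r : seq I) x (F : I -> G) :
  br x (\sum_(j <- r) F j) = \sum_(j <- r) br x (F j).
Proof. exact: (big_morph _ (lie_addr x) (lie_0r x)). Qed.

Variable n : nat.
Implicit Types (alpha : 'rV[K]_n.+1) (x y z : {ffun 'I_n.+1 -> G}).

Lemma alpha_bracketE alpha x y i :
  alpha_bracket br alpha x y i =
  \sum_s \sum_k W alpha s k i *: br (x s) (y k).
Proof. by rewrite ffunE. Qed.

Lemma alpha_bracket_bilinear alpha :
  bilinear_for *:%R *:%R (alpha_bracket (n := n) br alpha).
Proof.
split=> [y a x1 x2|x a y1 y2]; apply/ffunP=> i;
  rewrite !(alpha_bracketE, ffunE) scaler_sumr -big_split /=;
  apply: eq_bigr => s _; rewrite scaler_sumr -big_split /=;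
  apply: eq_bigr => k _; rewrite !ffunE ?br_linearl ?br_linearr scalerDr;
  by rewrite !scalerA mulrC.
Qed.

Lemma alpha_bracket_alternating alpha x : alpha_bracket br alpha x x = 0.
Proof.
apply/ffunP=> i; rewrite alpha_bracketE ffunE.
apply: sum_alternating => [s|s k]; first by rewrite lie_alternating scaler0.
by rewrite lie_anticomm scalerN WC.
Qed.

Lemma alpha_bracket_nested alpha x y z i :
  alpha_bracket br alpha x (alpha_bracket br alpha y z) i =
  \sum_a \sum_b \sum_c
    (\sum_k W alpha a k i * W alpha b c k) *: br (x a) (br (y b) (z c)).
Proof.
rewrite alpha_bracketE; apply: eq_bigr => a _.
under eq_bigr => k _ do rewrite alpha_bracketE lie_sumr scaler_sumr.
rewrite exchange_big; apply: eq_bigr => b _.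
under eq_bigr => k _ do rewrite lie_sumr scaler_sumr.
rewrite exchange_big; apply: eq_bigr => c _.
by rewrite scaler_suml; apply: eq_bigr => k _; rewrite lie_scaler scalerA.
Qed.

Lemma alpha_bracket_jacobi alpha x y z :
  alpha_bracket br alpha x (alpha_bracket br alpha y z) +
  alpha_bracket br alpha y (alpha_bracket br alpha z x) +
  alpha_bracket br alpha z (alpha_bracket br alpha x y) = 0.
Proof.
apply/ffunP=> i; rewrite [RHS]ffunE [LHS]ffunE [X in X + _]ffunE.
rewrite !alpha_bracket_nested.
(* The three sums range over triples (a, b, c), (b, c, a) and (c, a, b); the
   last two are put in the order of the first. *)
rewrite [X in _ + X]exchange_big /=.
under [X in _ + X + _]eq_bigr => b _ do rewrite exchange_big.
rewrite [X in _ + X + _]exchange_big -!big_split /=.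
rewrite big1 // => a _; rewrite [X in _ + X]exchange_big -!big_split /=.
rewrite big1 // => b _; rewrite -!big_split /= big1 // => c _.
rewrite (W_comp_rot _ i c a b) (W_comp_rot _ i a b c).
by rewrite -!scalerDr lie_jacobi scaler0.
Qed.

Lemma alpha_bracket_lie alpha : lie_bracket (alpha_bracket (n := n) br alpha).
Proof.
split; [exact: alpha_bracket_bilinear | exact: alpha_bracket_alternating |].
exact: alpha_bracket_jacobi.
Qed.

End LieBracket.

Section LinearityInParameter.

Variables (K : fieldType) (n : nat) (G : lmodType K) (br : G -> G -> G).
Implicit Types (alpha : 'rV[K]_n.+1) (x y : {ffun 'I_n.+1 -> G}).

Lemma alpha_bracketD alpha1 alpha2 x y :
  alpha_bracket br (alpha1 + alpha2) x y =
  alpha_bracket br alpha1 x y + alpha_bracket br alpha2 x y.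
Proof.
apply/ffunP=> i; rewrite !ffunE -big_split; apply: eq_bigr => s _ /=.
by rewrite -big_split; apply: eq_bigr => k _; rewrite mxE scalerDl.
Qed.

Lemma alpha_bracketZ a alpha x y :
  alpha_bracket br (a *: alpha) x y = a *: alpha_bracket br alpha x y.
Proof.
apply/ffunP=> i; rewrite !ffunE scaler_sumr; apply: eq_bigr => s _.
by rewrite scaler_sumr; apply: eq_bigr => k _; rewrite mxE scalerA.
Qed.

End LinearityInParameter.

Theorem mainTheorem1 (R : realType) (c : classical_field_kind) (n : nat) :
  let K : fieldType := classical_field R c in
  (forall alpha : 'rV[K]_n.+1,
     (forall i s p : 'I_n.+1, W alpha s p i = W alpha p s i) /\
     (forall i s q p : 'I_n.+1,
        \sum_(k < n.+1)
          (W alpha s k i * W alpha q p k - W alpha q k i * W alpha s p k) = 0))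
  /\
  (forall (G : lmodType K) (br : G -> G -> G), lie_bracket br ->
     (forall alpha : 'rV[K]_n.+1, lie_bracket (alpha_bracket br alpha)) /\
     linear_lie_bundle (fun alpha : 'rV[K]_n.+1 => alpha_bracket (n := n) br alpha)).
Proof.
move=> K; split=> [alpha | G br lie_br].
  split=> [i s p | i s q p]; first exact: WC.
  by rewrite sumrB W_compC subrr.
have lie_alpha := alpha_bracket_lie lie_br (n := n).
split=> //; split=> // [a1 a2 v1 v2 X Y | a v X Y].
  by rewrite alpha_bracketD.
exact: alpha_bracketZ.
Qed.
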